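(* Let $A\in\mathbb{R}^{m\times n}$ and $b\in\mathbb{R}^m$ be such that $Ax=b$ has a solution, let $B\in\mathbb{R}^{n\times n}$ be symmetric positive definite, let $S\in\mathbb{R}^{m\times q}$ be any matrix (a realization of the random sketching matrix), let $x^k\in\mathbb{R}^n$, and let $x^*\in\mathbb{R}^n$ be any vector with $Ax^*=b$. Then the following six descriptions of a point $x^{k+1}\in\mathbb{R}^n$ are equivalent: each of them determines a unique point $x^{k+1}$, and this point is the same for all six. 1. $x^{k+1}=\arg\min_{x\in\mathbb{R}^n}\|x-x^k\|_B^2$ subject to $S^\top A x=S^\top b$. 2. $x^{k+1}=\arg\min_{x\in\mathbb{R}^n}\|x-x^*\|_B^2$ subject to $x=x^k+B^{-1}A^\top S y$ with $y\in\mathbb{R}^q$ free. 3. $\{x^{k+1}\}=\left(x^*+\mathrm{Null}(S^\top A)\right)\cap\left(x^k+\mathrm{Range}(B^{-1}A^\top S)\right)$. 4. $x^{k+1}$ is the ($x$-component of the) solution of the linear system $S^\top A x=S^\top b,\ x=x^k+B^{-1}A^\top S y$ in the variables $(x,y)\in\mathbb{R}^n\times\mathbb{R}^q$. 5. $x^{k+1}=x^k-B^{-1}A^\top S(S^\top A B^{-1}A^\top S)^\dagger S^\top(Ax^k-b)$. 6. $x^{k+1}-x^*=(I-B^{-1}Z)(x^k-x^* )$, where $Z=A^\top S(S^\top AB^{-1}A^\top S)^\dagger S^\top A$.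
   Context: $\|x\|_B=\sqrt{x^\top B x}$. $M^\dagger$ denotes the Moore–Penrose pseudoinverse of $M$. $\mathrm{Null}(M)$ and $\mathrm{Range}(M)$ denote the null space and column space of $M$. *)

(* Defs.v *)
From mathcomp Require Import all_boot all_order all_algebra.
From mathcomp Require Import boolp classical_sets reals.
Set Implicit Arguments.
Unset Strict Implicit.
Unset Printing Implicit Defensive.
Import Order.TTheory GRing.Theory Num.Theory.
Local Open Scope classical_set_scope.
Local Open Scope ring_scope.

(* The four Penrose equations. *)
Definition moore_penrose (R : realFieldType) (m n : nat)
    (M : 'M[R]_(m, n)) (P : 'M[R]_(n, m)) : bool :=
  [&& M *m P *m M == M, P *m M *m P == P,
      (M *m P)^T == M *m P & (P *m M)^T == P *m M].

Lemma mulmx_tr_eq0 (R : realFieldType) (m n : nat) (M : 'M[R]_(m, n)) :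
  M *m M^T = 0 -> M = 0.
Proof.
move=> M0; apply/matrixP => i j; rewrite mxE.
have : (M *m M^T) i i = 0 by rewrite M0 mxE.
rewrite mxE => /psumr_eq0P-/(_ _ j isT).
by rewrite mxE => /(_ (fun k _ => _))/eqP; rewrite -expr2 sqrf_eq0 => H;
   apply/eqP/H => k; rewrite mxE -expr2 sqr_ge0.
Qed.

Lemma row_free_gram_unit (R : realFieldType) (m n : nat) (M : 'M[R]_(m, n)) :
  row_free M -> M *m M^T \in unitmx.
Proof.
move=> Mfree; rewrite -row_free_unit -kermx_eq0.
apply/eqP; set K := kermx _.
have K0 : K *m (M *m M^T) = 0 by exact: mulmx_ker.
have KM0 : K *m M = 0.
  by apply: mulmx_tr_eq0; rewrite trmx_mul mulmxA -(mulmxA K) K0 mul0mx.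
by apply: (row_free_inj Mfree); rewrite KM0 mul0mx.
Qed.

Lemma moore_penrose_factor (R : realFieldType) (m n r : nat)
    (C : 'M[R]_(m, r)) (F : 'M[R]_(r, n)) :
  row_free C^T -> row_free F ->
  moore_penrose (C *m F)
    (F^T *m invmx (F *m F^T) *m invmx (C^T *m C) *m C^T).
Proof.
move=> /row_free_gram_unit; rewrite trmxK => uC /row_free_gram_unit uF.
set G := invmx (F *m F^T); set H := invmx (C^T *m C).
have GT : G^T = G by rewrite /G trmx_inv trmx_mul trmxK.
have HT : H^T = H by rewrite /H trmx_inv trmx_mul trmxK.
have MP : C *m F *m (F^T *m G *m H *m C^T) = C *m H *m C^T.
  by rewrite !mulmxA -(mulmxA C F) -(mulmxA C _ G) mulmxV // mulmx1.
have PM : F^T *m G *m H *m C^T *m (C *m F) = F^T *m G *m F.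
  by rewrite !mulmxA -(mulmxA _ C^T C) -(mulmxA _ H) mulVmx // mulmx1.
rewrite /moore_penrose MP PM; apply/and4P; split; apply/eqP.
- by rewrite !mulmxA -(mulmxA _ C^T C) -(mulmxA C H) mulVmx // mulmx1.
- by rewrite !mulmxA -(mulmxA _ F F^T) -(mulmxA (F^T *m G)) mulmxV // mulmx1.
- by rewrite !trmx_mul HT trmxK mulmxA.
- by rewrite !trmx_mul GT trmxK mulmxA.
Qed.

Lemma moore_penrose_exists (R : realFieldType) (m n : nat) (M : 'M[R]_(m, n)) :
  exists P : 'M[R]_(n, m), moore_penrose M P.
Proof.
rewrite -[M in moore_penrose M]mulmx_base; eexists.
apply: moore_penrose_factor; last exact: row_base_free.
by rewrite /row_free mxrank_tr; apply: col_base_full.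
Qed.

Lemma moore_penrose_unique (R : realFieldType) (m n : nat) (M : 'M[R]_(m, n))
    (P Q : 'M[R]_(n, m)) :
  moore_penrose M P -> moore_penrose M Q -> P = Q.
Proof.
case/and4P=> /eqP MPM /eqP PMP /eqP MPT /eqP PMT.
case/and4P=> /eqP MQM /eqP QMQ /eqP MQT /eqP QMT.
have MPQ : M *m P = M *m Q.
  by rewrite -MPT -{1}MQM -(mulmxA _ M P) trmx_mul MPT MQT mulmxA MPM.
have PQM : P *m M = Q *m M.
  by rewrite -PMT -{1}MQM !mulmxA -(mulmxA _ Q) trmx_mul PMT QMT -mulmxA
             (mulmxA M) MPM.
by rewrite -PMP PQM -mulmxA MPQ mulmxA QMQ.
Qed.

Definition mpinv (R : realFieldType) (m n : nat) (M : 'M[R]_(m, n)) :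
  'M[R]_(n, m) := xchoose (moore_penrose_exists M).

Lemma mpinvP (R : realFieldType) (m n : nat) (M : 'M[R]_(m, n)) :
  moore_penrose M (mpinv M).
Proof. exact: xchooseP. Qed.

Definition sym_posdef (R : realFieldType) (n : nat) (B : 'M[R]_n) : Prop :=
  B^T = B /\ forall x : 'cV[R]_n, x != 0 -> 0 < (x^T *m B *m x) 0 0.

Definition normB (R : realType) (n : nat) (B : 'M[R]_n) (x : 'cV[R]_n) : R :=
  Num.sqrt ((x^T *m B *m x) 0 0).

(* The set of all minimizers; "x = argmin" asserts that it is the singleton
   of x. *)
Definition argmin (R : realType) (T : Type) (f : T -> R) (C : set T) : set T :=
  [set x | C x /\ forall y, C y -> f x <= f y].

Definition null_space (R : realType) (m n : nat) (M : 'M[R]_(m, n)) :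
  set 'cV[R]_n := [set v | M *m v = 0].

Definition col_space (R : realType) (m n : nat) (M : 'M[R]_(m, n)) :
  set 'cV[R]_m := [set M *m y | y in [set: 'cV[R]_n]].

Definition translate (R : realType) (n : nat) (x : 'cV[R]_n)
  (V : set 'cV[R]_n) : set 'cV[R]_n := [set x + v | v in V].

(* Main.v *)
(* In the B-inner product the subspaces Null(S^T A) and Range(B^-1 A^T S) are
   orthogonal complements, so the affine spaces xs + Null(S^T A) and
   xk + Range(B^-1 A^T S) meet in a single point z, and by Pythagoras z is the
   point of each of them closest to any point of the other. The identity
   W W^+ (S^T A) = S^T A shows that the pseudoinverse formula gives z. *)
Require Import Defs.
From mathcomp Require Import all_boot all_order all_algebra.
From mathcomp Require Import boolp classical_sets reals.
Import Order.TTheory GRing.Theory Num.Theory.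
Local Open Scope classical_set_scope.
Local Open Scope ring_scope.

Set Implicit Arguments.
Unset Strict Implicit.

Lemma sym_posdef_unit (R : realFieldType) (n : nat) (B : 'M[R]_n) :
  sym_posdef B -> B \in unitmx.
Proof.
case=> _ Bpos; rewrite -row_free_unit -kermx_eq0.
apply/eqP/row_matrixP => i; rewrite row0.
have rB : row i (kermx B) *m B = 0 by rewrite -row_mul mulmx_ker row0.
apply: trmx_inj; rewrite trmx0; apply/eqP; apply: contraT => /Bpos.
by rewrite trmxK rB mul0mx mxE ltxx.
Qed.

Lemma sym_posdef_ge0 (R : realFieldType) (n : nat) (B : 'M[R]_n) (v : 'cV_n) :
  sym_posdef B -> 0 <= (v^T *m B *m v) 0 0.
Proof.
case=> _ Bpos; have [->|/Bpos/ltW //] := eqVneq v 0.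
by rewrite mulmx0 mxE.
Qed.

(** The diagonal entries of [V^T *m B *m V] are the quadratic form of [B] at the columns of [V], so
    definiteness kills every column. *)
Lemma sym_posdef_mx_eq0 (R : realFieldType) (n p : nat) (B : 'M[R]_n)
    (V : 'M[R]_(n, p)) :
  sym_posdef B -> V^T *m B *m V = 0 -> V = 0.
Proof.
case=> _ Bpos V0; apply: trmx_inj; apply/row_matrixP => j.
rewrite trmx0 row0 -tr_col; apply: trmx_inj; rewrite trmxK trmx0.
apply/eqP; apply: contraT => /Bpos.
have -> : (col j V)^T *m B *m col j V = 0.
  rewrite colE trmx_mul !mulmxA -(mulmxA _ V^T) -(mulmxA _ (V^T *m B)) V0.
  by rewrite mulmx0 mul0mx.
by rewrite mxE ltxx.
Qed.

Lemma pythagoras (R : realFieldType) (n : nat) (B : 'M[R]_n) (u v : 'cV[R]_n) :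
  B^T = B -> u^T *m B *m v = 0 ->
  ((u + v)^T *m B *m (u + v)) 0 0
    = (u^T *m B *m u) 0 0 + (v^T *m B *m v) 0 0.
Proof.
move=> BT uv; have vu : v^T *m B *m u = 0.
  by apply: trmx_inj; rewrite trmx0 !trmx_mul trmxK BT mulmxA.
rewrite [(u + v)^T]linearD /= !mulmxDl !mulmxDr uv vu addr0 add0r.
by rewrite [LHS]mxE.
Qed.

(** With [W] the Gram matrix and [D = W *m mpinv W - 1%:M], a Penrose equation gives [D *m W = 0].
    Hence the Gram matrix of [C *m D^T] is [D *m W *m D^T = 0], and definiteness forces
    [C *m D^T = 0]. *)
Lemma mpinv_gramK (R : realFieldType) (n q : nat) (B : 'M[R]_n)
    (C : 'M[R]_(n, q)) :
  sym_posdef B ->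
  C^T *m B *m C *m mpinv (C^T *m B *m C) *m C^T = C^T.
Proof.
move=> Bpd; set W := C^T *m B *m C.
have /and4P[/eqP WPW _ _ _] := mpinvP W.
apply/eqP; rewrite -subr_eq0 -[X in _ - X]mul1mx -mulmxBl.
set D := W *m mpinv W - 1%:M.
have DW : D *m W = 0 by rewrite mulmxBl WPW mul1mx subrr.
apply/eqP; apply: trmx_inj; rewrite trmx0.
apply: (sym_posdef_mx_eq0 Bpd).
by rewrite trmxK trmx_mul trmxK -!mulmxA (mulmxA B) (mulmxA C^T)
  (mulmxA C^T B) (mulmxA D) DW mul0mx.
Qed.

Lemma normB_sqr (R : realType) (n : nat) (B : 'M[R]_n) (v : 'cV[R]_n) :
  sym_posdef B -> normB B v ^+ 2 = (v^T *m B *m v) 0 0.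
Proof. by move=> Bpd; rewrite sqr_sqrtr // sym_posdef_ge0. Qed.

(** By Pythagoras, moving from [z] to [u] inside [E] adds exactly the squared [B]-norm of [u - z],
    which is positive unless [u = z]. Both constrained problems reduce to this, with [c] equal to
    [xk] or [xs]. *)
Lemma argmin_normB (R : realType) (n : nat) (B : 'M[R]_n) (c z : 'cV[R]_n)
    (E : set 'cV[R]_n) :
  sym_posdef B -> E z ->
  (forall u, E u -> (z - c)^T *m B *m (u - z) = 0) ->
  argmin (fun u => normB B (u - c) ^+ 2) E = [set z].
Proof.
move=> Bpd Ez orth.
have dist u : E u -> normB B (u - c) ^+ 2
    = normB B (z - c) ^+ 2 + ((u - z)^T *m B *m (u - z)) 0 0.
  move=> Eu; rewrite !normB_sqr // -pythagoras ?orth //; last by case: Bpd.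
  by rewrite [z - c + _]addrC addrA subrK.
apply/seteqP; split=> [u [Eu /(_ z Ez)]|_ ->].
  rewrite (dist u Eu) gerDl => le0; apply/eqP; rewrite -subr_eq0.
  by apply: contraT => /(proj2 Bpd); rewrite ltNge le0.
by split=> // u Eu; rewrite (dist u Eu) lerDl sym_posdef_ge0.
Qed.

Lemma set1_eq_iff (T : Type) (E : set T) (x z : T) :
  E = [set z] -> ([set x] = E <-> x = z).
Proof.
move=> ->; split=> [xz|-> //].
by have : [set x] x by []; rewrite xz.
Qed.

Theorem theorem12 (R : realType) (m n q : nat)
    (A : 'M[R]_(m, n)) (b : 'cV[R]_m)
    (consistent : exists x : 'cV[R]_n, A *m x = b)
    (B : 'M[R]_n) (posdefB : sym_posdef B)
    (S : 'M[R]_(m, q)) (xk xs : 'cV[R]_n) (solxs : A *m xs = b) :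
  let W := S^T *m A *m invmx B *m A^T *m S in
  let Z := A^T *m S *m mpinv W *m S^T *m A in
  exists z : 'cV[R]_n, forall x : 'cV[R]_n,
    ([set x] = argmin (fun u => normB B (u - xk) ^+ 2)
                 [set u | S^T *m A *m u = S^T *m b] <-> x = z) /\
    ([set x] = argmin (fun u => normB B (u - xs) ^+ 2)
                 [set u | exists y : 'cV[R]_q,
                            u = xk + invmx B *m A^T *m S *m y] <-> x = z) /\
    ([set x] = translate xs (null_space (S^T *m A)) `&`
               translate xk (col_space (invmx B *m A^T *m S)) <-> x = z) /\
    ((exists y : 'cV[R]_q,
        S^T *m A *m x = S^T *m b /\
        x = xk + invmx B *m A^T *m S *m y) <-> x = z) /\
    (x = xk - invmx B *m A^T *m S *m mpinv W *m S^T *m (A *m xk - b)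
       <-> x = z) /\
    (x - xs = (1%:M - invmx B *m Z) *m (xk - xs) <-> x = z).
Proof.
move=> W Z.
have [BT _] := posdefB; have Bu := sym_posdef_unit posdefB.
set M := S^T *m A; set C := invmx B *m A^T *m S.
have CT : C^T = M *m invmx B by rewrite !trmx_mul trmxK trmx_inv BT mulmxA.
(* [M] is the adjoint of [C] when the [B]-inner product is used on the larger space; all
   orthogonality below comes from this. *)
have CB : C^T *m B = M by rewrite CT mulmxKV.
have WE : W = C^T *m B *m C by rewrite CB /C /W !mulmxA.
have MC : M *m C = W by rewrite WE CB.
have WK : W *m mpinv W *m M = M.
  by rewrite -[in RHS]CB -(mpinv_gramK C posdefB) -WE -CB !mulmxA.
have orth (y : 'cV_q) (v : 'cV_n) : M *m v = 0 -> (C *m y)^T *m B *m v = 0.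
  by move=> Mv; rewrite trmx_mul -(mulmxA y^T) CB -mulmxA Mv mulmx0.
have orthC (y : 'cV_q) (v : 'cV_n) : M *m v = 0 -> v^T *m B *m (C *m y) = 0.
  move=> /(orth y) o; apply: trmx_inj.
  by rewrite trmx0 trmx_mul (trmx_mul v^T) BT trmxK mulmxA.
(* Requiring [M *m (xk + C *m y) = M *m xs] means [W *m y = M *m (xs - xk)]; by [WK], [t] solves
   this system. *)
pose t := mpinv W *m (M *m (xs - xk)); pose z : 'cV_n := xk + C *m t.
have Mz : M *m z = M *m xs.
  rewrite mulmxDr (mulmxA M) MC /t (mulmxA W) (mulmxA (W *m _)) WK mulmxBr.
  by rewrite addrC subrK.
have Sb : S^T *m b = M *m xs by rewrite -solxs mulmxA.
have Mzs : M *m (z - xs) = 0 by rewrite mulmxBr Mz subrr.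
(* The difference of two such points lies in both the range of [C] and the kernel of [M], so it is
   [B]-orthogonal to itself. *)
have zuniq y : M *m (xk + C *m y) = M *m xs -> xk + C *m y = z.
  move=> My; apply/eqP; rewrite -subr_eq0; apply/eqP.
  have dE : xk + C *m y - z = C *m (y - t).
    by rewrite opprD addrACA subrr add0r mulmxBr.
  apply: (sym_posdef_mx_eq0 posdefB); rewrite {1}dE orth //.
  by rewrite mulmxBr My Mz subrr.
exists z => x; split; [|split; [|split; [|split; [|split]]]].
(* Here [z - xk] is in the range of [C] and [u - z] in the kernel of [M]; in the next case the two
   roles are swapped. *)
- apply: set1_eq_iff; apply: argmin_normB => //= [|u Mu]; first by rewrite Sb.
  by rewrite /z addrAC subrr add0r orth // mulmxBr Mu Mz Sb subrr.
- apply: set1_eq_iff; apply: argmin_normB => //= [|u [y ->]].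
    by exists t.
  by rewrite /z opprD addrACA subrr add0r -mulmxBr orthC.
- apply: set1_eq_iff; apply/seteqP; split=> [u [] [v Mv <-] [_ [y _ <-]] yu|_ ->].
    by rewrite /= -yu; apply: zuniq; rewrite yu mulmxDr Mv addr0.
  split; first by exists (z - xs) => //; rewrite addrC subrK.
  by exists (C *m t) => //; exists t.
- split=> [[y [My xE]]|->]; first by rewrite xE zuniq // -xE My.
  by exists t; rewrite Sb.
(* Since [b = A *m xs], the residual is [A *m (xk - xs)], and the formula unfolds to [z]. *)
- suff -> : xk - C *m mpinv W *m S^T *m (A *m xk - b) = z by [].
  by rewrite -solxs -mulmxBr /z /t -[xs - xk]opprB !mulmxN !mulmxA.
- have -> : (1%:M - invmx B *m Z) *m (xk - xs) = z - xs.
    rewrite mulmxBl mul1mx addrAC; congr (_ - _).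
    by rewrite /z /t -[xs - xk]opprB !mulmxN /Z /C /M !mulmxA.
  by split=> [/addIr|->].
Qed.
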